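(* Every ideal flow matrix is premagic.
   Context: Let $\mathbf{j}$ denote the all-ones column vector. A square matrix $M$ is called premagic if its vector of row sums equals the transpose of its vector of column sums, i.e. $M\mathbf{j}=(\mathbf{j}^{T}M)^{T}$. A network is a finite directed graph; it is irreducible if it is strongly connected. Given an irreducible network on nodes $\{1,\dots,n\}$, a random walk on it is a walk in which an agent located at node $i$ at time $t$ moves to node $j$ at time $t+1$ with a given probability $p_{ij}=\Pr(v_{t+1}=j\mid v_t=i)$, where $p_{ij}>0$ exactly when $(i,j)$ is a link. Suppose $N$ agents perform such random walks over a period of $T$ time steps. The flow on the link $(i,j)$ is the number $r_{ij}$ of times that the trajectories of the agents traverse the link $(i,j)$; let $R=[r_{ij}]$ (with $r_{ij}=0$ if $(i,j)$ is not a link). The relative flow is $R/\min R$, where $\min R$ denotes the minimum of the nonzero entries $r_{ij}$. An ideal flow matrix is a matrix $F$ that is the (almost sure) limit of the relative flow, $F=\lim_{N\cdot T\to\infty} R/\min R$, for such random walks on an irreducible network with a given transition probability. *)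

(* Defs.v *)
From HB Require Import structures.
From mathcomp Require Import all_boot all_order all_algebra.
From mathcomp Require Import all_classical all_reals all_analysis.
Set Implicit Arguments.
Unset Strict Implicit.
Unset Printing Implicit Defensive.
Import Order.TTheory GRing.Theory Num.Theory.
Import numFieldNormedType.Exports.
Local Open Scope classical_set_scope.
Local Open Scope ring_scope.

Definition premagic (R : pzSemiRingType) (n : nat) (M : 'M[R]_n) : Prop :=
  let j : 'cV[R]_n := const_mx 1 in M *m j = (j^T *m M)^T.

(* A network is a relation [e] on ['I_n] ([e i j] when (i, j) is a link);
   loops are allowed. *)
Definition irreducible_network (n : nat) (e : rel 'I_n) : Prop :=
  forall i j, connect e i j.

Definition transition_matrix (R : realType) (n : nat) (e : rel 'I_n)
    (p : 'M[R]_n) : Prop :=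
  [/\ forall i j, 0 <= p i j,
      forall i, \sum_j p i j = 1
    & forall i j, (0 < p i j) = e i j].

Definition cond_prob (R : realType) (d : measure_display)
    (Omega : measurableType d) (P : probability Omega R)
    (A B : set Omega) : R :=
  fine (P (A `&` B)) / fine (P B).

Definition history (Omega : Type) (n : nat) (v : nat -> Omega -> 'I_n)
    (t : nat) (s : nat -> 'I_n) : set Omega :=
  [set w | forall k, (k <= t)%N -> v k w = s k].

(* The transition probabilities are conditional on the whole past of the walk
   (Markov property); the initial distribution is arbitrary. *)
Definition random_walk (R : realType) (n : nat) (p : 'M[R]_n)
    (d : measure_display) (Omega : measurableType d) (P : probability Omega R)
    (v : nat -> Omega -> 'I_n) : Prop :=
  (forall t i, measurable [set w | v t w = i]) /\
  (forall t (s : nat -> 'I_n) j, P (history v t s) != 0%E ->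
     cond_prob P [set w | v t.+1 w = j] (history v t s) = p (s t) j).

(* [v a t] is the position of agent [a] at time [t]; a period of [T] time steps
   consists of the [T] moves from time [t] to [t.+1], for [t < T]. *)
Definition flow (n : nat) (e : rel 'I_n) (Omega : Type)
    (v : nat -> nat -> Omega -> 'I_n) (N T : nat) (w : Omega) : 'M[nat]_n :=
  \matrix_(i, j)
    if e i j then
      #|[set at_ : 'I_N * 'I_T |
          (v at_.1 at_.2 w == i) && (v at_.1 at_.2.+1 w == j)]%SET|
    else 0%N.

(* [minn] has no neutral element on [nat]: the bigop starts from the largest
   entry, which does not change the minimum when some entry is nonzero.  The
   value for the zero matrix is 0. *)
Definition min_nonzero (n : nat) (A : 'M[nat]_n) : nat :=
  \big[minn/(\max_(ij : 'I_n * 'I_n) A ij.1 ij.2)%N]_(ij : 'I_n * 'I_n |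
      A ij.1 ij.2 != 0%N) A ij.1 ij.2.

Definition relative_flow (R : realType) (n : nat) (A : 'M[nat]_n) : 'M[R]_n :=
  \matrix_(i, j) ((A i j)%:R / (min_nonzero A)%:R).

(* The filter of the double limit N * T -> oo: a limit along it does not depend
   on how N and T vary as long as N * T tends to infinity. *)
Definition prod_infty : set_system (nat * nat) :=
  filter_from setT (fun K => [set NT : nat * nat | (K <= NT.1 * NT.2)%N]).

Definition ideal_flow_matrix (R : realType) (n : nat) (F : 'M[R]_n) : Prop :=
  exists (e : rel 'I_n) (p : 'M[R]_n),
    [/\ irreducible_network e, transition_matrix e p
      & exists (d : measure_display) (Omega : measurableType d)
          (P : probability Omega R) (v : nat -> nat -> Omega -> 'I_n),
          (forall a, random_walk p P (v a)) /\
          {ae P, forall w,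
             relative_flow R (flow e v NT.1 NT.2 w) @[NT --> prod_infty] --> F}].

(* Main.v *)
Require Import Defs.
From mathcomp Require Import all_boot all_order all_algebra.
From mathcomp Require Import all_classical all_reals all_analysis.
Set Implicit Arguments.
Unset Strict Implicit.
Unset Printing Implicit Defensive.
Import Order.TTheory GRing.Theory Num.Theory.
Import numFieldNormedType.Exports.
Local Open Scope classical_set_scope.
Local Open Scope ring_scope.

(** A single agent suffices: along N = 1, T -> oo.  Almost surely every step of
    the walk follows a link, so the entries of the flow matrix A sum to T, while
    each row sum differs from the corresponding column sum by at most 1, because
    a trajectory leaves a node as often as it enters it, up to its two ends.
    Hence the defect of the relative flow A / min A is at most
    1 / min A = (T / min A) * (1 / T); as T / min A is the sum of the entries of
    the relative flow, it converges, and the defect tends to 0. *)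

Lemma flow1E (n : nat) (e : rel 'I_n) (Omega : Type)
    (v : nat -> nat -> Omega -> 'I_n) (T : nat) (w : Omega) (i j : 'I_n) :
  (forall t, e (v 0%N t w) (v 0%N t.+1 w)) ->
  flow e v 1 T w i j =
    (\sum_(t < T) ((v 0 t w == i) && (v 0 t.+1 w == j)))%N.
Proof.
move=> ev; rewrite mxE; case: ifPn => [_|eij]; last first.
  rewrite big1// => t _; apply/eqP; rewrite eqb0.
  by apply: contra eij => /andP[/eqP <- /eqP <-].
rewrite -sum1_card big_mkcond /=.
rewrite (eq_bigr (fun at_ : 'I_1 * 'I_T => ((v at_.1 at_.2 w == i) &&
  (v at_.1 at_.2.+1 w == j) : nat))) => [|at_ _]; last by rewrite inE; case: ifP.
by rewrite -(pair_bigA _ (fun (a : 'I_1) (t : 'I_T) => ((v a t w == i) &&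
  (v a t.+1 w == j) : nat))) /= big_ord1.
Qed.

Section FlowSums.
Variables (n : nat) (e : rel 'I_n) (Omega : Type).
Variables (v : nat -> nat -> Omega -> 'I_n) (w : Omega).
Hypothesis ev : forall t, e (v 0%N t w) (v 0%N t.+1 w).

Let sum_eqb (k : 'I_n) : (\sum_(j < n) (k == j) = 1)%N.
Proof. by rewrite (bigD1 k)//= eqxx big1// => j /negPf; rewrite eq_sym => ->. Qed.

Lemma flow1_row_sum T i :
  (\sum_j flow e v 1 T w i j = \sum_(t < T) (v 0 t w == i))%N.
Proof.
under eq_bigr do rewrite flow1E//.
rewrite exchange_big /=; apply: eq_bigr => t _.
by under eq_bigr do rewrite -mulnb; rewrite -big_distrr /= sum_eqb muln1.
Qed.

Lemma flow1_col_sum T i :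
  (\sum_j flow e v 1 T w j i = \sum_(t < T) (v 0 t.+1 w == i))%N.
Proof.
under eq_bigr do rewrite flow1E//.
rewrite exchange_big /=; apply: eq_bigr => t _.
by under eq_bigr do rewrite -mulnb; rewrite -big_distrl /= sum_eqb mul1n.
Qed.

Lemma flow1_sum T : (\sum_i \sum_j flow e v 1 T w i j = T)%N.
Proof.
under eq_bigr do rewrite flow1_row_sum.
rewrite exchange_big /=; under eq_bigr do rewrite sum_eqb.
by rewrite sum1_card card_ord.
Qed.

(** The row sum counts visits to [i] at times 0 to T-1, the column sum at times 1 to T; the
    difference telescopes to the indicators at times 0 and T. *)
Lemma flow1_defect (R : realType) T i :
  `|(\sum_j flow e v 1 T w i j)%N%:R - (\sum_j flow e v 1 T w j i)%N%:R| <= 1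
    :> R.
Proof.
rewrite flow1_row_sum flow1_col_sum !natr_sum -sumrB.
rewrite -(big_mkord xpredT
  (fun t => (v 0%N t w == i)%:R - (v 0%N t.+1 w == i)%:R)) /=.
under eq_bigr do rewrite -opprB.
rewrite sumrN (telescope_sumr (fun t => (v 0%N t w == i)%:R))// normrN.
by case: eqP => _; case: eqP => _;
  rewrite ?subrr ?subr0 ?sub0r ?normrN ?normr0 ?normr1.
Qed.

End FlowSums.

Lemma relative_flow_defect (R : realType) (n : nat) (e : rel 'I_n)
    (Omega : Type) (v : nat -> nat -> Omega -> 'I_n) (w : Omega) (T : nat) i :
  (forall t, e (v 0%N t w) (v 0%N t.+1 w)) ->
  let M := relative_flow R (flow e v 1 T.+1 w) in
  `|\sum_j M i j - \sum_j M j i| <= (\sum_k \sum_j M k j) * harmonic T.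
Proof.
move=> ev /=; set A := flow e v 1 T.+1 w; set c := (min_nonzero A)%:R^-1 : R.
have rowE k : \sum_j relative_flow R A k j = (\sum_j A k j)%N%:R * c.
  by rewrite natr_sum mulr_suml; apply: eq_bigr => j _; rewrite mxE.
have colE k : \sum_j relative_flow R A j k = (\sum_j A j k)%N%:R * c.
  by rewrite natr_sum mulr_suml; apply: eq_bigr => j _; rewrite mxE.
have c0 : 0 <= c by rewrite invr_ge0 ler0n.
rewrite rowE colE (eq_bigr _ (fun k _ => rowE k)).
rewrite -mulr_suml -natr_sum flow1_sum// -mulrBl normrM (ger0_norm c0).
(* [harmonic T] is the inverse of [T.+1], the total flow, so the right-hand side reduces to [c]. *)
rewrite [_ * c * _]mulrAC /harmonic /= divff ?pnatr_eq0// ler_wpM2r//.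
exact: flow1_defect.
Qed.

Section LinksAlmostSurely.
Variables (R : realType) (n : nat) (p : 'M[R]_n) (d : measure_display).
Variables (Omega : measurableType d) (P : probability Omega R).
Variable v : nat -> Omega -> 'I_n.
Hypothesis rw : random_walk p P v.

Lemma measurable_history t s : measurable (history v t s).
Proof.
have -> : history v t s = \bigcap_(k in `I_t.+1) [set w | v k w = s k].
  by apply/seteqP; split=> w /= h k kt; exact: h.
by apply: bigcap_measurableType => k _; exact: rw.1.
Qed.

(** A null history makes the intersection null by monotonicity; otherwise the quotient defining
    [cond_prob] vanishes, hence so does its numerator. *)
Lemma history_null_step t s j : p (s t) j = 0 ->
  P.-negligible ([set w | v t.+1 w = j] `&` history v t s).
Proof.
move=> p0; have mH := measurable_history t s.
have mI : measurable ([set w | v t.+1 w = j] `&` history v t s).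
  by apply: measurableI => //; exact: rw.1.
apply/negligibleP => //.
have [PH0|PH0] := eqVneq (P (history v t s)) 0%E.
  by apply/eqP; rewrite -measure_le0 -PH0 le_measure ?inE//; exact: subIsetr.
have /eqP := rw.2 t s j PH0; rewrite p0 /cond_prob mulf_eq0 invr_eq0.
by rewrite !fine_eq0 ?fin_num_measure// (negPf PH0) orbF => /eqP.
Qed.

Lemma null_step t i j : p i j = 0 ->
  P.-negligible [set w | v t w = i /\ v t.+1 w = j].
Proof.
move=> p0.
(* The event is split according to the path up to time t. Such paths form a finite type, so
   [unpickle] lists them in a countable union; the values of [hist f] beyond t are irrelevant. *)
pose hist (f : {ffun 'I_t.+1 -> 'I_n}) (k : nat) := f (inord k).
pose B (f : {ffun 'I_t.+1 -> 'I_n}) := if f ord_max == i then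
  [set w | v t.+1 w = j] `&` history v t (hist f) else set0.
pose F (k : nat) := if unpickle k is Some f then B f else set0.
apply: (@negligibleS _ _ _ P (\bigcup_k F k)).
  move=> w /= [vi vj]; pose f := [ffun k : 'I_t.+1 => v k w].
  exists (pickle f) => //; rewrite /F pickleK /B ffunE /= vi eqxx.
  by split=> // k kt; rewrite /hist ffunE inordK.
apply: negligible_bigcup => k; rewrite /F; case: unpickle => [f|]; last first.
  exact: negligible_set0.
rewrite /B; case: eqP => [fi|_]; last exact: negligible_set0.
apply: history_null_step; rewrite /hist.
have -> : inord t = ord_max :> 'I_t.+1 by apply: val_inj; rewrite /= inordK.
by rewrite fi.
Qed.

Lemma ae_steps_in_support :
  {ae P, forall w, forall t, p (v t w) (v t.+1 w) != 0}.
Proof.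
apply/ae_foralln => t.
(* The exceptional event at time t is covered by the pairs of nodes; the conjunct [p ij.1 ij.2 = 0]
   empties the sets of the other pairs. *)
pose F (k : nat) := if unpickle k is Some ij
  then [set w | p ij.1 ij.2 = 0 /\ (v t w = ij.1 /\ v t.+1 w = ij.2)]
  else set0.
apply: (@negligibleS _ _ _ P (\bigcup_k F k)).
  move=> w /= /negP; rewrite negbK => /eqP pw.
  by exists (pickle (v t w, v t.+1 w)) => //; rewrite /F pickleK.
apply: negligible_bigcup => k; rewrite /F; case: unpickle => [[i j]|] /=.
  have [p0|p0] := eqVneq (p i j) 0.
    by apply: negligibleS (null_step t p0) => w [].
  by apply: negligibleS (negligible_set0 _) => w [/eqP]; rewrite (negPf p0).
exact: negligible_set0.
Qed.

End LinksAlmostSurely.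

Lemma prod_infty_single_agent : (1%N, T.+1) @[T --> \oo] --> prod_infty.
Proof.
move=> A [K _ KA]; exists K => // T /= KT; apply: KA => /=.
by rewrite mul1n ltnW.
Qed.

Theorem corollary6p2 (R : realType) (n : nat) (F : 'M[R]_n) :
  ideal_flow_matrix F -> premagic F.
Proof.
case=> e [p [_ [p0 _ pe] [d [W [P [v [walks cvF]]]]]]].
have aeL := ae_steps_in_support (walks 0%N).
(* As P has mass 1, an almost sure property holds at some [w]; the rest of the argument is
   deterministic, along that one outcome. *)
have Pprop : ProperFilter (almost_everywhere P).
  apply: ae_properfilter_algebraOfSetsType => /=.
  by rewrite [P _]probability_setT lte01.
have [w [cvw linkw]] := filter_ex (filterI cvF aeL).
have ev t : e (v 0%N t w) (v 0%N t.+1 w).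
  by rewrite -pe lt0r linkw p0.
pose M T := relative_flow R (flow e v 1 T.+1 w).
have cvM i j : M T i j @[T --> \oo] --> F i j.
  have cvMF : M T @[T --> \oo] --> F.
    exact: (cvg_comp _ _ prod_infty_single_agent cvw).
  exact: (cvg_comp _ _ cvMF (@coord_continuous _ _ _ i j F)).
have cvsum (f : nat -> 'I_n -> R) (g : 'I_n -> R) :
    (forall j, f T j @[T --> \oo] --> g j) ->
    \sum_j f T j @[T --> \oo] --> \sum_j g j.
  by move=> fg; apply: cvg_big => // -[x y]; exact: add_continuous.
apply/matrixP => i k; rewrite !mxE.
under eq_bigr do rewrite mxE mulr1.
under [in RHS]eq_bigr do rewrite !mxE mul1r.
apply/eqP; rewrite -subr_eq0 -normr_le0.
have cvdef : `|\sum_j M T i j - \sum_j M T j i| @[T --> \oo]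
    --> `|\sum_j F i j - \sum_j F j i|.
  by apply: cvg_norm; apply: cvgB; apply: cvsum => j; exact: cvM.
(* The total relative flow converges to the sum of the entries of [F], so the factor [harmonic T]
   sends the bound to 0. *)
have cvbound : (\sum_k \sum_j M T k j) * harmonic T @[T --> \oo] --> (0 : R).
  rewrite -[X in _ --> X](mulr0 (\sum_k \sum_j F k j)).
  apply: cvgM; last exact: cvg_harmonic.
  by apply: (cvsum) => l; apply: (cvsum) => j; exact: cvM.
apply: ler_cvg_to cvdef cvbound _.
by apply: nearW => T; exact: relative_flow_defect.
Qed.
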